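(* Let $\mathbf{f}=(f_1,f_2,f_3):\mathbb{R}^3\to\mathbb{R}^3$ be a continuously differentiable vector field, and consider the control system on $\mathbb{R}^4$ with state $(x_1,x_2,x_3,x_4)$ and inputs $u_1,u_2,u_3$, $$\dot{x}_1=u_1,\quad \dot{x}_2=u_2,\quad \dot{x}_3=u_3,\quad \dot{x}_4=f_1(x_1,x_2,x_3)u_1+f_2(x_1,x_2,x_3)u_2+f_3(x_1,x_2,x_3)u_3.$$ The following are equivalent: (1) The system is controllable. (2) There exists a closed loop $\gamma$ in $\mathbb{R}^3$ such that the line integral $\oint_{\gamma}\mathbf{f}\cdot d\mathbf{x}\neq 0$. (3) The curl $\nabla\times\mathbf{f}$ is not identically zero on $\mathbb{R}^3$.
   Context: The system is controllable if for every pair of states $p,q$ in the state space there exist a finite time $T>0$ and piecewise continuous real-valued inputs on $[0,T]$ whose corresponding trajectory starts at $p$ at time $0$ and is at $q$ at time $T$. A closed loop is a piecewise continuously differentiable closed curve. $\nabla\times\mathbf{f}$ denotes the usual curl of a vector field on $\mathbb{R}^3$. *)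

(* Defs.v *)
From Stdlib Require Import Reals.
From Coquelicot Require Import Coquelicot.

Open Scope R_scope.

Notation R3 := (R * R * R)%type.
Notation R4 := (R * R * R * R)%type.

Definition c1 (v : R3) : R := fst (fst v).
Definition c2 (v : R3) : R := snd (fst v).
Definition c3 (v : R3) : R := snd v.

Definition dot (v w : R3) : R := c1 v * c1 w + c2 v * c2 w + c3 v * c3 w.

(** ** Differential calculus on R^3 *)

Definition line1 (g : R3 -> R) (v : R3) : R -> R := fun s => g (s, c2 v, c3 v).
Definition line2 (g : R3 -> R) (v : R3) : R -> R := fun s => g (c1 v, s, c3 v).
Definition line3 (g : R3 -> R) (v : R3) : R -> R := fun s => g (c1 v, c2 v, s).

Definition partial1 (g : R3 -> R) (v : R3) : R := Derive (line1 g v) (c1 v).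
Definition partial2 (g : R3 -> R) (v : R3) : R := Derive (line2 g v) (c2 v).
Definition partial3 (g : R3 -> R) (v : R3) : R := Derive (line3 g v) (c3 v).

(** [continuous] is joint continuity, for the product topology of [R3]. *)
Definition C1_fun (g : R3 -> R) : Prop :=
  forall v : R3,
    (ex_derive (line1 g v) (c1 v) /\ continuous (partial1 g) v) /\
    (ex_derive (line2 g v) (c2 v) /\ continuous (partial2 g) v) /\
    (ex_derive (line3 g v) (c3 v) /\ continuous (partial3 g) v).

Definition C1_field (f : R3 -> R3) : Prop :=
  C1_fun (fun v => c1 (f v)) /\
  C1_fun (fun v => c2 (f v)) /\
  C1_fun (fun v => c3 (f v)).

Definition curl (f : R3 -> R3) (v : R3) : R3 :=
  (partial2 (fun w => c3 (f w)) v - partial3 (fun w => c2 (f w)) v,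
   partial3 (fun w => c1 (f w)) v - partial1 (fun w => c3 (f w)) v,
   partial1 (fun w => c2 (f w)) v - partial2 (fun w => c1 (f w)) v).

(** ** Piecewise regularity on a compact interval *)

Definition is_partition (a b : R) (n : nat) (s : nat -> R) : Prop :=
  s 0%nat = a /\ s n = b /\ forall i : nat, (i < n)%nat -> s i < s (S i).

(** Continuity on the open interval with finite one-sided limits at its ends;
    the values at the ends themselves play no role. *)
Definition continuous_piece (g : R -> R) (c d : R) : Prop :=
  (forall t : R, c < t < d -> continuous g t) /\
  (exists l : R, filterlim g (at_right c) (locally l)) /\
  (exists l : R, filterlim g (at_left d) (locally l)).

Definition piecewise_continuous (a b : R) (g : R -> R) : Prop :=
  exists (n : nat) (s : nat -> R), is_partition a b n s /\
    forall i : nat, (i < n)%nat -> continuous_piece g (s i) (s (S i)).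

(** For a continuous [g], finite one-sided limits of the derivative at the
    ends of a piece are the one-sided derivatives there, so [g] is of class C1
    on each closed piece. *)
Definition piecewise_C1 (a b : R) (g : R -> R) : Prop :=
  continuous_on (fun t => a <= t <= b) g /\
  exists (n : nat) (s : nat -> R), is_partition a b n s /\
    forall i : nat, (i < n)%nat ->
      (forall t : R, s i < t < s (S i) -> ex_derive g t) /\
      continuous_piece (Derive g) (s i) (s (S i)).

(** ** Closed loops and line integrals *)

(** The components may be given different partitions: a common refinement
    serves for all three. *)
Definition closed_loop (a b : R) (gamma : R -> R3) : Prop :=
  a < b /\
  piecewise_C1 a b (fun t => c1 (gamma t)) /\
  piecewise_C1 a b (fun t => c2 (gamma t)) /\
  piecewise_C1 a b (fun t => c3 (gamma t)) /\
  gamma a = gamma b.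

Definition velocity (gamma : R -> R3) (t : R) : R3 :=
  (Derive (fun s => c1 (gamma s)) t,
   Derive (fun s => c2 (gamma s)) t,
   Derive (fun s => c3 (gamma s)) t).

(** Along a piecewise C1 curve the integrand is piecewise continuous; the
    arbitrary values of [Derive] at the finitely many break points do not
    affect the integral. *)
Definition line_integral (f : R3 -> R3) (gamma : R -> R3) (a b : R) : R :=
  RInt (fun t => dot (f (gamma t)) (velocity gamma t)) a b.

(** ** The control system *)

(** A state [(x1, x2, x3, x4) : R4] is the pair of [(x1, x2, x3) : R3] and [x4]. *)
Definition system_rhs (f : R3 -> R3) (x : R4) (u : R3) : R4 :=
  (c1 u, c2 u, c3 u, dot (f (fst x)) u).

(** The differential equation is required wherever the inputs are continuous,
    hence at all but finitely many times when they are piecewise continuous. *)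
Definition is_trajectory (f : R3 -> R3) (T : R) (u : R -> R3) (x : R -> R4) : Prop :=
  continuous_on (fun t => 0 <= t <= T) x /\
  forall t : R, 0 < t < T -> continuous u t ->
    is_derive x t (system_rhs f (x t) (u t)).

Definition controllable (f : R3 -> R3) : Prop :=
  forall p q : R4,
    exists (T : R) (u : R -> R3) (x : R -> R4),
      0 < T /\
      piecewise_continuous 0 T (fun t => c1 (u t)) /\
      piecewise_continuous 0 T (fun t => c2 (u t)) /\
      piecewise_continuous 0 T (fun t => c3 (u t)) /\
      is_trajectory f T u x /\
      x 0 = p /\ x T = q.

(* Main.v *)
From Pilot Require Import Defs.
From Stdlib Require Import Reals Lra Lia Classical.
From Coquelicot Require Import Coquelicot.
(* The real analysis just imported has a [c1] and a [C1_fun] of its own, hidden again here. *)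
Import Pilot.Defs.

Open Scope R_scope.

(** The first three coordinates can be driven along any smooth enough curve, and the fourth one
    then records the line integral of the field along it: [x4] is a holonomy coordinate.

    Controllability gives a loop with nonzero integral: a trajectory from the origin to
    [(0, 0, 0, 1)] projects to a closed curve of [R^3], and its line integral is the increment
    of [x4], which is 1 ([controllable_loop]).

    A loop with nonzero integral forces the curl not to vanish: a curl-free C1 field on [R^3] has
    the potential obtained by integrating along the three axes one after the other
    ([curl_free_potential]), and a gradient integrates to 0 over closed curves
    ([conservative_loop]). Both directions so far rest on one fundamental theorem of calculus for
    continuous functions whose derivative is only piecewise continuous ([ftc_pieces]).

    If the curl does not vanish at [v], the circulation around some coordinate rectangle with
    corner [v] is not 0: were all these circulations 0, differentiating in one side length and
    then in the other would give 0 for the matching component of the curl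
    ([circulation_nonzero]). Shrinking a side varies the circulation continuously down to 0, so
    that turning several times around a suitable rectangle changes [x4] by any prescribed real
    number while returning to [v] ([rectangle_loops], [curl_loops]). To steer [p] to [q], go
    to [v] along the axes, correct [x4] there, and proceed to [q] ([curl_controllable]).

    Trajectories are concatenated without any break point: only controls that are continuous on
    the whole line and vanish outside the time interval are used ([steers]), and two such
    motions are glued by adding them ([steers_trans]). *)

(** * Differential calculus on R^3 *)

Lemma is_linear_c1 : is_linear c1.
Proof. apply (is_linear_comp fst fst); apply is_linear_fst. Qed.

Lemma is_linear_c2 : is_linear c2.
Proof. apply (is_linear_comp fst snd); [apply is_linear_fst | apply is_linear_snd]. Qed.

Lemma is_linear_c3 : is_linear c3.
Proof. apply is_linear_snd. Qed.

Lemma is_linear_Rplus (U : NormedModule R_AbsRing) (l1 l2 : U -> R) :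
  is_linear l1 -> is_linear l2 -> is_linear (fun u => l1 u + l2 u).
Proof.
  intros H1 H2.
  apply (is_linear_comp (fun u => (l1 u, l2 u)) (fun p => plus (fst p) (snd p))).
  - now apply is_linear_prod.
  - exact (is_linear_plus (V := R_NormedModule)).
Qed.

Lemma is_linear_Rmult (U : NormedModule R_AbsRing) (k : R) (l : U -> R) :
  is_linear l -> is_linear (fun u => k * l u).
Proof.
  intros H. apply (is_linear_comp l (scal k) H).
  exact (is_linear_scal_r (V := R_NormedModule) k Rmult_comm).
Qed.

Lemma is_linear_dot (v : R3) : is_linear (dot v).
Proof.
  unfold dot. repeat apply is_linear_Rplus; apply is_linear_Rmult;
    [apply is_linear_c1 | apply is_linear_c2 | apply is_linear_c3].
Qed.

Lemma is_derive_pair (U V : NormedModule R_AbsRing) (g : R -> U) (h : R -> V) (t : R)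
  (dg : U) (dh : V) :
  is_derive g t dg -> is_derive h t dh ->
  is_derive (V := prod_NormedModule R_AbsRing U V) (fun s => (g s, h s)) t (dg, dh).
Proof.
  intros Hg Hh.
  apply (filterdiff_comp'_2 g h (fun a b => (a, b)) t _ _ (fun a b => (a, b)) Hg Hh).
  apply filterdiff_linear, is_linear_prod; [apply is_linear_fst | apply is_linear_snd].
Qed.

Lemma is_derive_linear_comp (U V : NormedModule R_AbsRing) (l : U -> V) (g : R -> U) (t : R)
  (dg : U) : is_linear l -> is_derive g t dg -> is_derive (fun s => l (g s)) t (l dg).
Proof.
  intros Hl Hg.
  apply filterdiff_ext_lin with (fun y => l (scal y dg)).
  - apply (filterdiff_comp' g l t _ _ Hg). now apply filterdiff_linear.
  - intros y. now apply linear_scal.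
Qed.

(** The mean value inequality applied to [h] minus the linear function of slope [l]. *)
Lemma mvt_line (h dh : R -> R) (a b l eps : R) :
  (forall s, is_derive h s (dh s)) ->
  (forall s, Rmin a b <= s <= Rmax a b -> Rabs (dh s - l) <= eps) ->
  Rabs (h b - h a - l * (b - a)) <= eps * Rabs (b - a).
Proof.
  intros Hd He.
  destruct (MVT_gen h a b dh) as [s [Hs ->]].
  - intros s _. apply Hd.
  - intros s _. apply continuity_pt_filterlim, (ex_derive_continuous h). eexists; apply Hd.
  - replace (dh s * (b - a) - l * (b - a)) with ((dh s - l) * (b - a)) by ring.
    rewrite Rabs_mult. apply Rmult_le_compat_r; [apply Rabs_pos | auto].
Qed.

(** Partial derivatives continuous at one point give a total differential there: going from [v]
    to [w] parallel to the axes, one coordinate at a time, each of the three increments is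
    controlled by [mvt_line] on a box around [v] where the partials vary little. *)
Lemma total_differential (g g1 g2 g3 : R3 -> R) (v : R3) :
  (forall w, is_derive (line1 g w) (c1 w) (g1 w)) ->
  (forall w, is_derive (line2 g w) (c2 w) (g2 w)) ->
  (forall w, is_derive (line3 g w) (c3 w) (g3 w)) ->
  continuous g1 v -> continuous g2 v -> continuous g3 v ->
  filterdiff g (locally v) (dot (g1 v, g2 v, g3 v)).
Proof.
  intros H1 H2 H3 C1 C2 C3. split.
  - apply is_linear_dot.
  - intros v' Hv'.
    apply (is_filter_lim_locally_unique (V := prod_NormedModule R_AbsRing (prod_NormedModule R_AbsRing R_NormedModule R_NormedModule) R_NormedModule)) in Hv'.
    subst v'. intros eps.
    assert (He : 0 < eps / 3) by (generalize (cond_pos eps); lra).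
    assert (Hball : locally v (fun w => Rabs (g1 w - g1 v) < eps / 3 /\
      Rabs (g2 w - g2 v) < eps / 3 /\ Rabs (g3 w - g3 v) < eps / 3)).
    { repeat apply filter_and;
      [apply (C1 _ (locally_ball _ (mkposreal _ He))) | apply (C2 _ (locally_ball _ (mkposreal _ He))) | apply (C3 _ (locally_ball _ (mkposreal _ He)))]. }
    destruct Hball as [d Hd]. exists d. intros w Hw.
    destruct v as [[x y] z], w as [[x' y'] z'].
    destruct Hw as [[Hx Hy] Hz]. simpl in Hx, Hy, Hz.
    change (Rabs (x' - x) < d) in Hx. change (Rabs (y' - y) < d) in Hy. change (Rabs (z' - z) < d) in Hz.
    assert (Hbox : forall a b c, Rabs (a - x) < d -> Rabs (b - y) < d -> Rabs (c - z) < d ->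
       Rabs (g1 (a,b,c) - g1 (x,y,z)) < eps / 3 /\
      Rabs (g2 (a,b,c) - g2 (x,y,z)) < eps / 3 /\ Rabs (g3 (a,b,c) - g3 (x,y,z)) < eps / 3).
    { intros a b c Ha Hb Hc. apply Hd. repeat split; assumption. }
    assert (Hz0 : forall a, Rabs (a - a) < d) by (intros a; rewrite Rminus_diag, Rabs_R0; apply cond_pos).
    (* The three segments of the path stay in the box. *)
    assert (Hbtw : forall a b s, Rabs (b - a) < d -> Rmin a b <= s <= Rmax a b -> Rabs (s - a) < d).
    { intros a b s. unfold Rmin, Rmax; destruct (Rle_dec a b); unfold Rabs; repeat destruct Rcase_abs; lra. }
    assert (K1 := mvt_line (fun s => g (s, y', z')) (fun s => g1 (s, y', z')) x x' (g1 (x,y,z)) (eps / 3)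
       (fun s => H1 (s, y', z'))).
    assert (K2 := mvt_line (fun s => g (x, s, z')) (fun s => g2 (x, s, z')) y y' (g2 (x,y,z)) (eps / 3)
       (fun s => H2 (x, s, z'))).
    assert (K3 := mvt_line (fun s => g (x, y, s)) (fun s => g3 (x, y, s)) z z' (g3 (x,y,z)) (eps / 3)
       (fun s => H3 (x, y, s))).
    cbv beta in K1, K2, K3.
    specialize (K1 ltac:(intros s Hs; left; apply Hbox; eauto)).
    specialize (K2 ltac:(intros s Hs; left; apply Hbox; eauto)).
    specialize (K3 ltac:(intros s Hs; left; apply Hbox; eauto)).
    match goal with |- _ <= _ * ?n => set (N := n) end.
    assert (HN : Rabs (x' - x) <= N /\ Rabs (y' - y) <= N /\ Rabs (z' - z) <= N).
    { unfold N. destruct (norm_prod (K:=R_AbsRing) (x' - x, y' - y) (z' - z)) as [Ha _].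
      destruct (norm_prod (K:=R_AbsRing) (x' - x) (y' - y)) as [Hb _].
      change (norm (x' - x)) with (Rabs (x' - x)) in Hb.
      change (norm (y' - y)) with (Rabs (y' - y)) in Hb.
      change (norm (z' - z)) with (Rabs (z' - z)) in Ha.
      assert (J1 := Rmax_l (Rabs (x' - x)) (Rabs (y' - y))).
      assert (J2 := Rmax_r (Rabs (x' - x)) (Rabs (y' - y))).
      assert (J3 := Rmax_l (norm (x' - x, y' - y)) (Rabs (z' - z))).
      assert (J4 := Rmax_r (norm (x' - x, y' - y)) (Rabs (z' - z))).
      repeat split; eapply Rle_trans; try exact Ha; try assumption.
      - eapply Rle_trans; [exact J1|]. eapply Rle_trans; [apply Hb|]. exact J3.
      - eapply Rle_trans; [exact J2|]. eapply Rle_trans; [apply Hb|]. exact J3. }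
    clearbody N. destruct HN as [N1 [N2 N3]].
    change (Rabs (g (x', y', z') - g (x, y, z) -
       (g1 (x,y,z) * (x' - x) + g2 (x,y,z) * (y' - y) + g3 (x,y,z) * (z' - z))) <= eps * N).
    replace (g (x', y', z') - g (x, y, z) -
       (g1 (x,y,z) * (x' - x) + g2 (x,y,z) * (y' - y) + g3 (x,y,z) * (z' - z)))
     with ((g (x', y', z') - g (x, y', z') - g1 (x,y,z) * (x' - x)) +
           (g (x, y', z') - g (x, y, z') - g2 (x,y,z) * (y' - y)) +
           (g (x, y, z') - g (x, y, z) - g3 (x,y,z) * (z' - z))) by ring.
    eapply Rle_trans; [apply Rabs_triang|].
    eapply Rle_trans; [apply Rplus_le_compat_r, Rabs_triang|].
    apply (Rmult_le_compat_l (eps / 3)) in N1, N2, N3; try lra.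
    replace (eps * N) with (eps / 3 * N + eps / 3 * N + eps / 3 * N) by field.
    repeat apply Rplus_le_compat; eapply Rle_trans; eassumption.
Qed.

Lemma is_derive_chain (g : R3 -> R) (gamma : R -> R3) (t : R) (grad : R3) (d1 d2 d3 : R) :
  filterdiff g (locally (gamma t)) (dot grad) ->
  is_derive (fun s => c1 (gamma s)) t d1 ->
  is_derive (fun s => c2 (gamma s)) t d2 ->
  is_derive (fun s => c3 (gamma s)) t d3 ->
  is_derive (fun s => g (gamma s)) t (dot grad (d1, d2, d3)).
Proof.
  intros Hg H1 H2 H3.
  assert (Hc : is_derive gamma t (d1, d2, d3)).
  { apply is_derive_ext with (fun s => (c1 (gamma s), c2 (gamma s), c3 (gamma s))).
    - intros s. now destruct (gamma s) as [[? ?] ?].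
    - apply is_derive_pair; [apply is_derive_pair|]; assumption. }
  apply filterdiff_ext_lin with (fun y : R => dot grad (scal y (d1, d2, d3))).
  - apply (filterdiff_comp' gamma g t _ _ Hc Hg).
  - intros y. apply (linear_scal (dot grad)), is_linear_dot.
Qed.

Lemma C1_fun_differentiable (g : R3 -> R) (v : R3) :
  C1_fun g -> filterdiff g (locally v) (dot (partial1 g v, partial2 g v, partial3 g v)).
Proof.
  intros Hg.
  destruct (Hg v) as [[_ K1] [[_ K2] [_ K3]]].
  apply total_differential; trivial; intros w; apply Derive_correct;
    destruct (Hg w) as [[? _] [[? _] [? _]]]; assumption.
Qed.

Lemma C1_fun_continuous (g : R3 -> R) (v : R3) : C1_fun g -> continuous g v.
Proof.
  intros Hg.
  exact (filterdiff_continuous g v (ex_intro _ _ (C1_fun_differentiable g v Hg))).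
Qed.

(** * Subdivisions of an interval and the piecewise fundamental theorem *)

(** The subdivisions of [is_partition] in inductive form, so that splitting, concatenation and
    common refinement go by induction instead of reindexing. *)
Inductive pieces (P : R -> R -> Prop) : R -> R -> Prop :=
| pieces_nil a : pieces P a a
| pieces_cons a c b : a < c -> P a c -> pieces P c b -> pieces P a b.

Lemma pieces_of_partition (P : R -> R -> Prop) (n : nat) : forall (s : nat -> R) (a b : R),
  is_partition a b n s -> (forall i : nat, (i < n)%nat -> P (s i) (s (S i))) -> pieces P a b.
Proof.
  induction n as [|n IH]; intros s a b [Ha [Hb Hs]] HP.
  - rewrite <- Ha, <- Hb. constructor.
  - apply pieces_cons with (s 1%nat).
    + rewrite <- Ha. apply Hs. lia.
    + rewrite <- Ha. apply HP. lia.
    + apply IH with (fun i => s (S i)).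
      * repeat split; trivial. intros i Hi. apply Hs. lia.
      * intros i Hi. apply HP. lia.
Qed.

Lemma partition_of_pieces (P : R -> R -> Prop) (a b : R) :
  pieces P a b -> exists (n : nat) (s : nat -> R), is_partition a b n s /\
    forall i : nat, (i < n)%nat -> P (s i) (s (S i)).
Proof.
  induction 1 as [a|a c b Hac HP _ [n [s [[Hc [Hb Hs]] HsP]]]].
  - exists 0%nat, (fun _ => a). repeat split; lia.
  - exists (S n), (fun i => match i with O => a | S j => s j end).
    repeat split; trivial; intros [|i] Hi.
    + now rewrite Hc.
    + apply Hs. lia.
    + now rewrite Hc.
    + apply HsP. lia.
Qed.

Lemma pieces_le (P : R -> R -> Prop) (a b : R) : pieces P a b -> a <= b.
Proof. induction 1; lra. Qed.

Lemma pieces_mono (P Q : R -> R -> Prop) (a b : R) :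
  pieces P a b -> (forall c d, a <= c -> c < d -> d <= b -> P c d -> Q c d) -> pieces Q a b.
Proof.
  induction 1 as [a|a c b Hac HP Hp IH]; intros HPQ; [constructor|].
  apply pieces_le in Hp.
  apply pieces_cons with c; trivial.
  - apply HPQ; trivial; lra.
  - apply IH. intros x y Hx Hxy Hy. apply HPQ; lra.
Qed.

Lemma pieces_app (P : R -> R -> Prop) (a b c : R) :
  pieces P a b -> pieces P b c -> pieces P a c.
Proof.
  intros H1 H2. induction H1 as [|a e b Hae HP _ IH]; trivial.
  apply pieces_cons with e; auto.
Qed.

Definition hereditary (P : R -> R -> Prop) : Prop :=
  forall a b c d, a <= c -> c < d -> d <= b -> P a b -> P c d.

Lemma pieces_split (P : R -> R -> Prop) (a b c : R) :
  hereditary P -> pieces P a b -> a <= c <= b -> pieces P a c /\ pieces P c b.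
Proof.
  intros HP H. induction H as [a|a e b Hae HPe Hp IH]; intros Hc.
  - replace c with a by lra. split; constructor.
  - destruct (Rle_lt_dec e c) as [Hec|Hce].
    + destruct IH as [H1 H2]; [lra|]. split; trivial. now apply pieces_cons with e.
    + split.
      * destruct (Rle_lt_or_eq_dec a c) as [Hac| ->]; [lra| |constructor].
        apply pieces_cons with c; [trivial| |constructor].
        apply (HP a e); lra || trivial.
      * apply pieces_cons with e; trivial. apply (HP a e); lra || trivial.
Qed.

(** The common refinement of two subdivisions. *)
Lemma pieces_and (P Q : R -> R -> Prop) (a b : R) :
  hereditary P -> hereditary Q -> pieces P a b -> pieces Q a b ->
  pieces (fun c d => P c d /\ Q c d) a b.
Proof.
  intros HP HQ H. induction H as [a|a c b Hac HPac Hp IH]; intros Hq; [constructor|].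
  assert (Hcb := pieces_le _ _ _ Hp).
  destruct (pieces_split Q a b c HQ Hq) as [Hq1 Hq2]; [lra|].
  apply pieces_app with c; [|auto].
  apply pieces_mono with (1 := Hq1).
  intros x y Hx Hxy Hy HQxy. split; trivial. apply (HP a c); trivial.
Qed.

Lemma hereditary_and (P Q : R -> R -> Prop) :
  hereditary P -> hereditary Q -> hereditary (fun c d => P c d /\ Q c d).
Proof. intros HP HQ a b c d H1 H2 H3 [H4 H5]. split; [apply (HP a b) | apply (HQ a b)]; trivial. Qed.

Lemma at_right_lt (c d : R) : c < d -> at_right c (fun t => c < t < d).
Proof.
  intros H. assert (Hd : 0 < d - c) by lra. exists (mkposreal _ Hd). intros y Hy Hc.
  change (Rabs (y - c) < d - c) in Hy. apply Rabs_def2 in Hy. lra.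
Qed.

Lemma at_left_lt (c d : R) : c < d -> at_left d (fun t => c < t < d).
Proof.
  intros H. assert (Hd : 0 < d - c) by lra. exists (mkposreal _ Hd). intros y Hy Hc.
  change (Rabs (y - d) < d - c) in Hy. apply Rabs_def2 in Hy. lra.
Qed.

Lemma locally_open (c d t : R) : c < t < d -> locally t (fun s => c < s < d).
Proof.
  intros H. apply (open_and (fun s => c < s) (fun s => s < d)); trivial.
  - apply open_gt.
  - apply open_lt.
Qed.

(** Used for one-sided limits, which are limits within a half-line. *)
Lemma continuous_within (U V : UniformSpace) (g : U -> V) (D : U -> Prop) (x : U) :
  continuous g x -> filterlim g (within D (locally x)) (locally (g x)).
Proof. intros Hg P HP. destruct (Hg P HP) as [e He]. exists e. intros y Hy _. now apply He. Qed.

Lemma continuous_piece_hereditary (g : R -> R) : hereditary (continuous_piece g).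
Proof.
  intros a b c d Hac Hcd Hdb [Hg [Ha Hb]]. split; [|split].
  - intros t Ht. apply Hg. lra.
  - destruct (Rle_lt_or_eq_dec _ _ Hac) as [H| <-]; trivial.
    exists (g c). apply continuous_within. apply Hg. lra.
  - destruct (Rle_lt_or_eq_dec _ _ Hdb) as [H| ->]; trivial.
    exists (g d). apply continuous_within. apply Hg. lra.
Qed.

Lemma continuous_piece_ext (g h : R -> R) (c d : R) :
  c < d -> (forall t, c < t < d -> g t = h t) -> continuous_piece g c d -> continuous_piece h c d.
Proof.
  intros Hcd Hgh [Hg [[l Hl] [r Hr]]]. split; [|split].
  - intros t Ht. apply continuous_ext_loc with g; [|auto].
    apply filter_imp with (2 := locally_open c d t Ht). auto.
  - exists l. apply filterlim_ext_loc with (2 := Hl).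
    apply filter_imp with (2 := at_right_lt c d Hcd). auto.
  - exists r. apply filterlim_ext_loc with (2 := Hr).
    apply filter_imp with (2 := at_left_lt c d Hcd). auto.
Qed.

Lemma continuous_piece_comp_2 (op : R -> R -> R) (g h : R -> R) (c d : R) :
  (forall p q, filterlim (fun z : R * R => op (fst z) (snd z)) (filter_prod (locally p) (locally q))
     (locally (op p q))) ->
  continuous_piece g c d -> continuous_piece h c d ->
  continuous_piece (fun t => op (g t) (h t)) c d.
Proof.
  intros Hop [Hg [[gl Hgl] [gr Hgr]]] [Hh [[hl Hhl] [hr Hhr]]]. split; [|split].
  - intros t Ht. eapply filterlim_comp_2; [exact (Hg t Ht) | exact (Hh t Ht) | apply Hop].
  - exists (op gl hl). eapply filterlim_comp_2; [exact Hgl | exact Hhl | apply Hop].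
  - exists (op gr hr). eapply filterlim_comp_2; [exact Hgr | exact Hhr | apply Hop].
Qed.

Lemma continuous_piece_dot (v w : R -> R3) (c d : R) :
  continuous_piece (fun t => c1 (v t)) c d -> continuous_piece (fun t => c2 (v t)) c d ->
  continuous_piece (fun t => c3 (v t)) c d ->
  continuous_piece (fun t => c1 (w t)) c d -> continuous_piece (fun t => c2 (w t)) c d ->
  continuous_piece (fun t => c3 (w t)) c d ->
  continuous_piece (fun t => dot (v t) (w t)) c d.
Proof.
  intros. unfold dot.
  assert (Hp : forall p q : R, filterlim (fun z : R * R => fst z + snd z)
    (filter_prod (locally p) (locally q)) (locally (p + q))) by exact filterlim_plus.
  assert (Hm : forall p q : R, filterlim (fun z : R * R => fst z * snd z)
    (filter_prod (locally p) (locally q)) (locally (p * q))) by exact filterlim_mult.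
  apply (continuous_piece_comp_2 Rplus); trivial.
  - apply (continuous_piece_comp_2 Rplus); trivial; apply (continuous_piece_comp_2 Rmult); trivial.
  - apply (continuous_piece_comp_2 Rmult); trivial.
Qed.

(** The retraction of the line onto [[c, d]]; composing with it turns continuity on the segment
    into continuity everywhere, as the mean value theorem and the integral expect. *)
Definition clamp (c d t : R) : R := Rmax c (Rmin t d).

Lemma clamp_bounds (c d t : R) : c <= d -> c <= clamp c d t <= d.
Proof. intros H. unfold clamp, Rmax, Rmin. repeat destruct Rle_dec; lra. Qed.

Lemma clamp_id (c d t : R) : c <= t <= d -> clamp c d t = t.
Proof. intros H. unfold clamp, Rmax, Rmin. repeat destruct Rle_dec; lra. Qed.

Lemma clamp_continuous (c d t : R) : continuous (clamp c d) t.
Proof.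
  apply (filterlim_locally (F := locally t)). intros eps. exists eps. intros y Hy.
  change (Rabs (y - t) < eps) in Hy. change (Rabs (clamp c d y - clamp c d t) < eps).
  apply Rle_lt_trans with (2 := Hy).
  unfold clamp, Rmax, Rmin. repeat destruct Rle_dec; unfold Rabs; repeat destruct Rcase_abs; lra.
Qed.

Lemma clamp_comp_continuous (U : UniformSpace) (g : R -> U) (c d t : R) :
  c <= d -> continuous_on (fun s => c <= s <= d) g -> continuous (fun s => g (clamp c d s)) t.
Proof.
  intros Hcd Hg. apply filterlim_comp with (2 := Hg _ (clamp_bounds c d t Hcd)).
  intros P HP.
  assert (H : locally t (fun s => c <= clamp c d s <= d -> P (clamp c d s)))
    by exact (clamp_continuous c d t _ HP).
  apply filter_imp with (2 := H). intros s Hs. apply Hs, clamp_bounds, Hcd.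
Qed.

Lemma continuous_piece_continuous (g : R -> R) (c d : R) :
  (forall t, continuous g t) -> continuous_piece g c d.
Proof.
  intros Hg. split; [intros t _; apply Hg|]. split.
  - exists (g c). apply continuous_within. apply Hg.
  - exists (g d). apply continuous_within. apply Hg.
Qed.

Lemma continuous_piece_continuous_on (g : R -> R) (a b c d : R) :
  a <= c -> c < d -> d <= b ->
  continuous_on (fun t => a <= t <= b) g -> continuous_piece g c d.
Proof.
  intros Hac Hcd Hdb Hg.
  apply continuous_piece_ext with (fun t => g (clamp a b t)); trivial.
  - intros t Ht. rewrite clamp_id; lra.
  - apply continuous_piece_continuous. intros t. apply clamp_comp_continuous; trivial. lra.
Qed.

(** The one-sided limits are the values at the ends of the extension. *)
Lemma continuous_piece_extension (g : R -> R) (c d : R) :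
  c < d -> continuous_piece g c d ->
  exists G : R -> R, (forall t, continuous G t) /\ forall t, c < t < d -> G t = g t.
Proof.
  intros Hcd [Hg [[l Hl] [r Hr]]].
  set (H := fun t => if Rle_dec t c then l else if Rle_dec d t then r else g t).
  assert (Hin : forall t, c < t < d -> H t = g t).
  { intros t Ht. unfold H. repeat destruct Rle_dec; lra. }
  assert (Hc : H c = l) by (unfold H; destruct Rle_dec; lra).
  assert (Hd : H d = r) by (unfold H; repeat destruct Rle_dec; lra).
  exists (fun t => H (clamp c d t)). split.
  - intros t. apply clamp_comp_continuous; [lra|].
    intros s Hs.
    destruct (Rle_lt_or_eq_dec c s) as [Hcs| <-]; [lra| |].
    + destruct (Rle_lt_or_eq_dec s d) as [Hsd| ->]; [lra| |].
      * apply continuous_within.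
        apply continuous_ext_loc with g; [|apply Hg; lra].
        apply filter_imp with (2 := locally_open c d s (conj Hcs Hsd)).
        intros u Hu. now rewrite Hin.
      * rewrite Hd. intros P HP.
        assert (HP' := filter_and _ _ (at_left_lt c d Hcd) (Hr P HP)).
        destruct HP' as [e He]. exists e. intros u Hue Hb. assert (Hu := He u Hue).
        destruct (Rle_lt_or_eq_dec u d) as [Hud| ->]; [lra| |].
        -- destruct (Hu Hud) as [Hu1 Hu2]. now rewrite Hin.
        -- rewrite Hd. now apply locally_singleton.
    + rewrite Hc. intros P HP.
      assert (HP' := filter_and _ _ (at_right_lt c d Hcd) (Hl P HP)).
      destruct HP' as [e He]. exists e. intros u Hue Hb. assert (Hu := He u Hue).
      destruct (Rle_lt_or_eq_dec c u) as [Hud| <-]; [lra| |].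
      -- destruct (Hu Hud) as [Hu1 Hu2]. now rewrite Hin.
      -- rewrite Hc. now apply locally_singleton.
  - intros t Ht. rewrite clamp_id by lra. auto.
Qed.

(** With [G] a continuous extension of [g], the difference of [F] and the primitive of [G] has
    derivative 0 inside and is continuous up to the ends, hence is constant. *)
Lemma ftc_piece (F g : R -> R) (c d : R) :
  c < d -> continuous_on (fun t => c <= t <= d) F ->
  (forall t, c < t < d -> is_derive F t (g t)) -> continuous_piece g c d ->
  is_RInt g c d (F d - F c).
Proof.
  intros Hcd HF Hd Hg.
  destruct (continuous_piece_extension g c d Hcd Hg) as [G [HG HGg]].
  assert (HI : forall t, is_RInt G c t (RInt G c t)).
  { intros t. apply (RInt_correct G), (ex_RInt_continuous G). auto. }
  assert (HdI : forall t, is_derive (fun s => RInt G c s) t (G t)).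
  { intros t. apply (is_derive_RInt G _ c); [|apply HG].
    apply filter_forall. exact HI. }
  destruct (MVT_gen (fun t => F (clamp c d t) - RInt G c t) c d (fun _ => 0)) as [s [_ Hs]].
  - rewrite Rmin_left, Rmax_right by lra. intros t Ht.
    replace 0 with (g t - G t) by (rewrite HGg; [ring | trivial]).
    apply (is_derive_minus (V := R_NormedModule)); [|apply HdI].
    apply is_derive_ext_loc with F; [|auto].
    apply filter_imp with (2 := locally_open c d t Ht). intros u Hu. rewrite clamp_id; lra.
  - intros t _. apply continuity_pt_filterlim.
    apply (continuous_minus (V := R_NormedModule) (fun t => F (clamp c d t)) (fun t => RInt G c t)).
    + apply clamp_comp_continuous; trivial. lra.
    + apply (ex_derive_continuous (fun t => RInt G c t)). eexists. apply HdI.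
  - cbv beta in Hs. rewrite !clamp_id, RInt_point in Hs by lra. unfold zero in Hs; simpl in Hs.
    apply is_RInt_ext with G.
    + rewrite Rmin_left, Rmax_right by lra. exact HGg.
    + replace (F d - F c) with (RInt G c d) by lra. apply HI.
Qed.

Lemma ftc_pieces (F g : R -> R) (a b : R) :
  continuous_on (fun t => a <= t <= b) F ->
  pieces (fun c d => (forall t, c < t < d -> is_derive F t (g t)) /\ continuous_piece g c d) a b ->
  is_RInt g a b (F b - F a).
Proof.
  intros HF H. induction H as [a|a c b Hac [Hd Hg] Hp IH].
  - rewrite Rminus_diag. apply (is_RInt_point (V := R_NormedModule)).
  - assert (Hcb := pieces_le _ _ _ Hp).
    replace (F b - F a) with (@plus R_NormedModule (F c - F a) (F b - F c)) by (unfold plus; simpl; ring).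
    apply (is_RInt_Chasles (V := R_NormedModule)) with c.
    + apply ftc_piece; trivial. apply continuous_on_subset with (2 := HF). intros t Ht. lra.
    + apply IH. apply continuous_on_subset with (2 := HF). intros t Ht. lra.
Qed.

(** * Line integrals along loops *)

Lemma continuous_pair (T U V : UniformSpace) (g : T -> U) (h : T -> V) (t : T) :
  continuous g t -> continuous h t -> continuous (fun s => (g s, h s)) t.
Proof.
  intros Hg Hh. apply (continuous_comp_2 g h (fun a b => (a, b)) t Hg Hh).
  apply continuous_ext with (fun z => z); [now intros [? ?] | apply continuous_id].
Qed.

Lemma continuous_triple (T : UniformSpace) (g1 g2 g3 : T -> R) (t : T) :
  continuous g1 t -> continuous g2 t -> continuous g3 t ->
  continuous (fun s => (g1 s, g2 s, g3 s) : R3) t.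
Proof. intros H1 H2 H3. now repeat apply continuous_pair. Qed.

Lemma continuous_on_comp (T U V : UniformSpace) (D : T -> Prop) (g : T -> U) (h : U -> V) :
  continuous_on D g -> (forall y, continuous h y) -> continuous_on D (fun t => h (g t)).
Proof. intros Hg Hh t Ht. apply filterlim_comp with (1 := Hg t Ht). apply Hh. Qed.

Lemma continuous_c1 (v : R3) : continuous c1 v.
Proof. apply (linear_cont c1 v is_linear_c1). Qed.

Lemma continuous_c2 (v : R3) : continuous c2 v.
Proof. apply (linear_cont c2 v is_linear_c2). Qed.

Lemma continuous_c3 (v : R3) : continuous c3 v.
Proof. apply (linear_cont c3 v is_linear_c3). Qed.

Lemma continuous_on_of_clamp (U : UniformSpace) (g : R -> U) (a b : R) :
  (forall t, continuous (fun s => g (clamp a b s)) t) -> continuous_on (fun t => a <= t <= b) g.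
Proof.
  intros Hg t Ht. rewrite <- (clamp_id a b t) at 2 by exact Ht.
  apply filterlim_ext_loc with (fun s => g (clamp a b s)).
  - apply (filter_forall (F := locally t)). intros s Hs. now rewrite clamp_id.
  - apply (continuous_within _ _ (fun s => g (clamp a b s))). apply Hg.
Qed.

Definition C1_piece (g : R -> R) (c d : R) : Prop :=
  (forall t : R, c < t < d -> ex_derive g t) /\ continuous_piece (Derive g) c d.

Lemma C1_piece_hereditary (g : R -> R) : hereditary (C1_piece g).
Proof.
  intros a b c d Hac Hcd Hdb [H1 H2]. split.
  - intros t Ht. apply H1. lra.
  - now apply (continuous_piece_hereditary _ a b).
Qed.

(** The one computation of line integrals that is needed: [F] is the fourth state in
    [controllable_loop] and the potential along the curve in [conservative_loop]. *)
Lemma line_integral_ftc (f : R3 -> R3) (gamma : R -> R3) (F : R -> R) (a b : R) :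
  (forall v, continuous f v) ->
  continuous_on (fun t => a <= t <= b) gamma ->
  continuous_on (fun t => a <= t <= b) F ->
  pieces (fun c d => C1_piece (fun t => c1 (gamma t)) c d /\
    C1_piece (fun t => c2 (gamma t)) c d /\ C1_piece (fun t => c3 (gamma t)) c d /\
    forall t, c < t < d -> is_derive F t (dot (f (gamma t)) (velocity gamma t))) a b ->
  line_integral f gamma a b = F b - F a.
Proof.
  intros Hf Hgamma HF Hp. unfold line_integral. apply is_RInt_unique, ftc_pieces; trivial.
  apply pieces_mono with (1 := Hp).
  intros c d Hac Hcd Hdb [[_ H1] [[_ H2] [[_ H3] Hd]]]. split; trivial.
  assert (Hfg := continuous_on_comp _ _ _ _ _ _ Hgamma Hf).
  apply continuous_piece_dot; trivial; apply (continuous_piece_continuous_on _ a b); trivial.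
  - apply (continuous_on_comp _ _ _ _ _ c1 Hfg continuous_c1).
  - apply (continuous_on_comp _ _ _ _ _ c2 Hfg continuous_c2).
  - apply (continuous_on_comp _ _ _ _ _ c3 Hfg continuous_c3).
Qed.

Lemma C1_field_continuous (f : R3 -> R3) (v : R3) : C1_field f -> continuous f v.
Proof.
  intros [H1 [H2 H3]].
  apply continuous_ext with (fun w => (c1 (f w), c2 (f w), c3 (f w))).
  - intros w. now destruct (f w) as [[? ?] ?].
  - apply continuous_triple; now apply C1_fun_continuous.
Qed.

Lemma closed_loop_pieces (a b : R) (gamma : R -> R3) :
  closed_loop a b gamma ->
  continuous_on (fun t => a <= t <= b) gamma /\
  pieces (fun c d => C1_piece (fun t => c1 (gamma t)) c d /\
    C1_piece (fun t => c2 (gamma t)) c d /\ C1_piece (fun t => c3 (gamma t)) c d) a b.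
Proof.
  intros [Hab [[C1 [n1 [s1 [Hs1 P1]]]] [[C2 [n2 [s2 [Hs2 P2]]]] [[C3 [n3 [s3 [Hs3 P3]]]] _]]]].
  split.
  - apply continuous_on_of_clamp. intros t.
    apply continuous_ext with (fun s => (c1 (gamma (clamp a b s)), c2 (gamma (clamp a b s)),
      c3 (gamma (clamp a b s)))).
    + intros s. now destruct (gamma (clamp a b s)) as [[? ?] ?].
    + apply continuous_triple;
        [apply (clamp_comp_continuous _ (fun s => c1 (gamma s)))
        |apply (clamp_comp_continuous _ (fun s => c2 (gamma s)))
        |apply (clamp_comp_continuous _ (fun s => c3 (gamma s)))]; trivial; lra.
  - apply pieces_and; [| apply hereditary_and | | apply pieces_and]; try apply C1_piece_hereditary.
    + apply (pieces_of_partition _ n1 s1); trivial.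
    + apply (pieces_of_partition _ n2 s2); trivial.
    + apply (pieces_of_partition _ n3 s3); trivial.
Qed.

(** The loop is the projection of a trajectory from the origin to [(0, 0, 0, 1)]; on a common
    subdivision for the three inputs, all of them are continuous at once, which is where the
    differential equation is known to hold. *)
Lemma controllable_loop (f : R3 -> R3) :
  C1_field f -> controllable f ->
  exists (a b : R) (gamma : R -> R3), closed_loop a b gamma /\ line_integral f gamma a b <> 0.
Proof.
  intros Hf Hc.
  destruct (Hc (0, 0, 0, 0) (0, 0, 0, 1)) as
    [T [u [x [HT [[n1 [s1 [Hs1 P1]]] [[n2 [s2 [Hs2 P2]]] [[n3 [s3 [Hs3 P3]]] [[Hx Hode] [H0 HT1]]]]]]]]].
  set (gamma := fun t => fst (x t)).
  assert (Hgamma : continuous_on (fun t => 0 <= t <= T) gamma).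
  { apply (continuous_on_comp _ _ _ _ x fst Hx). intros y. apply continuous_fst. }
  assert (Hx4 : continuous_on (fun t => 0 <= t <= T) (fun t => snd (x t))).
  { apply (continuous_on_comp _ _ _ _ x snd Hx). intros y. apply continuous_snd. }
  assert (Hp : pieces (fun c d => continuous_piece (fun t => c1 (u t)) c d /\
     continuous_piece (fun t => c2 (u t)) c d /\ continuous_piece (fun t => c3 (u t)) c d) 0 T).
  { apply pieces_and; [| apply hereditary_and | | apply pieces_and]; try apply continuous_piece_hereditary.
    - apply (pieces_of_partition _ n1 s1); trivial.
    - apply (pieces_of_partition _ n2 s2); trivial.
    - apply (pieces_of_partition _ n3 s3); trivial. }
  assert (Hq : pieces (fun c d => C1_piece (fun t => c1 (gamma t)) c d /\
    C1_piece (fun t => c2 (gamma t)) c d /\ C1_piece (fun t => c3 (gamma t)) c d /\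
    forall t, c < t < d -> is_derive (fun t => snd (x t)) t (dot (f (gamma t)) (velocity gamma t))) 0 T).
  { apply pieces_mono with (1 := Hp).
    intros c d Hc0 Hcd HdT [U1 [U2 U3]].
    assert (Hd : forall t, c < t < d -> is_derive x t (system_rhs f (x t) (u t))).
    { intros t Ht. apply Hode; [lra|].
      apply continuous_ext with (fun s => (c1 (u s), c2 (u s), c3 (u s))).
      - intros s. now destruct (u s) as [[? ?] ?].
      - apply continuous_triple; [apply U1 | apply U2 | apply U3]; exact Ht. }
    assert (Hdg : forall t, c < t < d -> is_derive gamma t (u t)).
    { intros t Ht.
      replace (u t) with (fst (system_rhs f (x t) (u t))) by (now destruct (u t) as [[? ?] ?]).
      apply (is_derive_linear_comp _ _ fst x); [apply is_linear_fst | auto]. }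
    assert (Hd1 : forall t, c < t < d -> is_derive (fun s => c1 (gamma s)) t (c1 (u t))).
    { intros t Ht. apply (is_derive_linear_comp _ _ c1 gamma); [apply is_linear_c1 | auto]. }
    assert (Hd2 : forall t, c < t < d -> is_derive (fun s => c2 (gamma s)) t (c2 (u t))).
    { intros t Ht. apply (is_derive_linear_comp _ _ c2 gamma); [apply is_linear_c2 | auto]. }
    assert (Hd3 : forall t, c < t < d -> is_derive (fun s => c3 (gamma s)) t (c3 (u t))).
    { intros t Ht. apply (is_derive_linear_comp _ _ c3 gamma); [apply is_linear_c3 | auto]. }
    assert (HC : forall g h : R -> R, (forall t, c < t < d -> is_derive g t (h t)) ->
      continuous_piece h c d -> C1_piece g c d).
    { intros g h Hgh Hh. split.
      - intros t Ht. eexists. now apply Hgh.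
      - apply continuous_piece_ext with h; trivial. intros t Ht. symmetry.
        now apply is_derive_unique, Hgh. }
    split; [|split; [|split]].
    - now apply (HC _ _ Hd1).
    - now apply (HC _ _ Hd2).
    - now apply (HC _ _ Hd3).
    - intros t Ht.
      assert (E : velocity gamma t = u t).
      { unfold velocity. rewrite (surjective_pairing (u t)), (surjective_pairing (fst (u t))).
        repeat apply f_equal2; apply is_derive_unique; auto. }
      rewrite E.
      replace (dot _ _) with (snd (system_rhs f (x t) (u t)))
        by (now destruct (u t) as [[? ?] ?]).
      apply (is_derive_linear_comp _ _ snd x); [apply is_linear_snd | auto]. }
  exists 0, T, gamma. split.
  - assert (HC : forall g : R -> R, continuous_on (fun t => 0 <= t <= T) g ->
      pieces (C1_piece g) 0 T -> piecewise_C1 0 T g).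
    { intros g Hg Hpg. split; trivial. exact (partition_of_pieces _ _ _ Hpg). }
    split; [trivial|]. split; [|split; [|split]].
    + apply HC; [exact (continuous_on_comp _ _ _ _ _ c1 Hgamma continuous_c1)|].
      apply pieces_mono with (1 := Hq). tauto.
    + apply HC; [exact (continuous_on_comp _ _ _ _ _ c2 Hgamma continuous_c2)|].
      apply pieces_mono with (1 := Hq). tauto.
    + apply HC; [exact (continuous_on_comp _ _ _ _ _ c3 Hgamma continuous_c3)|].
      apply pieces_mono with (1 := Hq). tauto.
    + unfold gamma. now rewrite H0, HT1.
  - rewrite (line_integral_ftc f gamma (fun t => snd (x t))); trivial.
    + rewrite H0, HT1. simpl. lra.
    + intros v. now apply C1_field_continuous.
Qed.

Lemma conservative_loop (f : R3 -> R3) (phi : R3 -> R) (a b : R) (gamma : R -> R3) :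
  (forall v, continuous f v) -> (forall v, filterdiff phi (locally v) (dot (f v))) ->
  closed_loop a b gamma -> line_integral f gamma a b = 0.
Proof.
  intros Hf Hphi Hg. destruct (closed_loop_pieces a b gamma Hg) as [Hgamma Hp].
  rewrite (line_integral_ftc f gamma (fun t => phi (gamma t))); trivial.
  - destruct Hg as [_ [_ [_ [_ ->]]]]. ring.
  - apply (continuous_on_comp _ _ _ _ _ phi Hgamma). intros v.
    exact (filterdiff_continuous phi v (ex_intro _ _ (Hphi v))).
  - apply pieces_mono with (1 := Hp). intros c d _ _ _ [H1 [H2 H3]].
    repeat (split; [assumption|]). intros t Ht.
    apply is_derive_chain; [apply Hphi | | | ]; apply Derive_correct.
    + now apply H1.
    + now apply H2.
    + now apply H3.
Qed.

(** Differentiation under the integral sign. *)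
Lemma is_derive_RInt_slice (g dg : R -> R -> R) (a b x : R) :
  (forall y t, is_derive (fun u => g u t) y (dg y t)) ->
  (forall y t, continuous (fun z : R * R => dg (fst z) (snd z)) (y, t)) ->
  (forall y t, continuous (g y) t) ->
  is_derive (fun y => RInt (g y) a b) x (RInt (dg x) a b).
Proof.
  intros Hd Hdg Hg.
  rewrite (RInt_ext _ (fun t => Derive (fun u => g u t) x)).
  - apply is_derive_RInt_param.
    + apply filter_forall. intros y t _. eexists. apply Hd.
    + intros t _. apply continuity_2d_pt_ext with dg.
      * intros u v. symmetry. apply is_derive_unique, Hd.
      * apply continuity_2d_pt_filterlim. apply Hdg.
    + apply filter_forall. intros y. apply (ex_RInt_continuous (g y)). auto.
  - intros t _. symmetry. apply is_derive_unique, Hd.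
Qed.

Lemma RInt_derive_eq (h dh : R -> R) (a b : R) :
  (forall s, is_derive h s (dh s)) -> (forall s, continuous dh s) -> RInt dh a b = h b - h a.
Proof.
  intros Hd Hc. apply is_RInt_unique.
  apply (is_RInt_derive h dh); auto.
Qed.

Lemma is_derive_RInt_upper (h : R -> R) (a x : R) :
  (forall s, continuous h s) -> is_derive (fun y => RInt h a y) x (h x).
Proof.
  intros Hc. apply (is_derive_RInt h _ a); [|apply Hc].
  apply filter_forall. intros y. apply (RInt_correct h), (ex_RInt_continuous h). auto.
Qed.

Lemma C1_fun_line1 (g : R3 -> R) (x y z : R) :
  C1_fun g -> is_derive (fun s => g (s, y, z)) x (partial1 g (x, y, z)).
Proof. intros Hg. apply Derive_correct. apply (Hg (x, y, z)). Qed.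

Lemma C1_fun_line2 (g : R3 -> R) (x y z : R) :
  C1_fun g -> is_derive (fun s => g (x, s, z)) y (partial2 g (x, y, z)).
Proof. intros Hg. apply Derive_correct. apply (Hg (x, y, z)). Qed.

Lemma C1_fun_line3 (g : R3 -> R) (x y z : R) :
  C1_fun g -> is_derive (fun s => g (x, y, s)) z (partial3 g (x, y, z)).
Proof. intros Hg. apply Derive_correct. apply (Hg (x, y, z)). Qed.

Lemma C1_fun_partial1_continuous (g : R3 -> R) (v : R3) : C1_fun g -> continuous (partial1 g) v.
Proof. intros Hg. apply (Hg v). Qed.

Lemma C1_fun_partial2_continuous (g : R3 -> R) (v : R3) : C1_fun g -> continuous (partial2 g) v.
Proof. intros Hg. apply (Hg v). Qed.

Lemma C1_fun_partial3_continuous (g : R3 -> R) (v : R3) : C1_fun g -> continuous (partial3 g) v.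
Proof. intros Hg. apply (Hg v). Qed.

Lemma continuous_comp_triple (T : UniformSpace) (g : R3 -> R) (g1 g2 g3 : T -> R) (t : T) :
  (forall v, continuous g v) ->
  continuous g1 t -> continuous g2 t -> continuous g3 t ->
  continuous (fun s => g (g1 s, g2 s, g3 s)) t.
Proof.
  intros Hg H1 H2 H3. apply (continuous_comp (fun s => (g1 s, g2 s, g3 s)) g); [|apply Hg].
  now apply continuous_triple.
Qed.

(** Continuity of a C1 function, or of one of its partial derivatives, in some of the coordinates
    while the others are fixed. *)
Ltac C1_slice_continuous :=
  apply continuous_comp_triple;
  [ intros ?;
    lazymatch goal with
    | |- continuous (partial1 _) _ => apply C1_fun_partial1_continuous
    | |- continuous (partial2 _) _ => apply C1_fun_partial2_continuous
    | |- continuous (partial3 _) _ => apply C1_fun_partial3_continuous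
    | |- _ => apply C1_fun_continuous
    end; assumption
  | first [apply continuous_id | apply continuous_const | apply continuous_fst
          | apply continuous_snd] .. ].

(** The potential is the integral of [f] from the origin to [v] along a path parallel to the axes,
    first axis first. Differentiating under the integral sign and exchanging the partials by the
    vanishing of the curl, each derivative telescopes to a component of [f]. *)
Lemma curl_free_potential (f : R3 -> R3) :
  C1_field f -> (forall v, curl f v = (0, 0, 0)) ->
  exists phi : R3 -> R, forall v, filterdiff phi (locally v) (dot (f v)).
Proof.
  intros Hf Hcurl. assert (Hc := fun v => C1_field_continuous f v Hf).
  destruct Hf as [F1 [F2 F3]].
  set (f1 := fun v => c1 (f v)) in *. set (f2 := fun v => c2 (f v)) in *.
  set (f3 := fun v => c3 (f v)) in *.
  assert (E32 : forall v, partial2 f3 v = partial3 f2 v).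
  { intros v. assert (E := f_equal c1 (Hcurl v)). unfold curl, c1 in E. simpl in E. 
    unfold f3, f2, c1, c2, c3 in *. lra. }
  assert (E13 : forall v, partial1 f3 v = partial3 f1 v).
  { intros v. assert (E := f_equal c2 (Hcurl v)). unfold curl, c2 in E. simpl in E.
    unfold f3, f1, c1, c2, c3 in *. lra. }
  assert (E21 : forall v, partial1 f2 v = partial2 f1 v).
  { intros v. assert (E := f_equal c3 (Hcurl v)). unfold curl, c3 in E. simpl in E.
    unfold f1, f2, c1, c2, c3 in *. lra. }
  exists (fun v => RInt (fun s => f1 (s, 0, 0)) 0 (c1 v) + RInt (fun s => f2 (c1 v, s, 0)) 0 (c2 v)
    + RInt (fun s => f3 (c1 v, c2 v, s)) 0 (c3 v)).
  intros v. replace (f v) with (f1 v, f2 v, f3 v) by (unfold f1, f2, f3; now destruct (f v) as [[? ?] ?]).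
  apply total_differential; try now apply C1_fun_continuous.
  - intros [[x y] z]. unfold line1, c1, c2, c3; simpl.
    replace (f1 (x, y, z)) with (f1 (x, 0, 0) + RInt (fun s => partial1 f2 (x, s, 0)) 0 y
      + RInt (fun s => partial1 f3 (x, y, s)) 0 z).
    + apply (is_derive_plus (V := R_NormedModule)); [apply (is_derive_plus (V := R_NormedModule))|].
      * apply (is_derive_RInt_upper (fun s => f1 (s, 0, 0))). intros s. C1_slice_continuous.
      * apply (is_derive_RInt_slice (fun x s => f2 (x, s, 0)) (fun x s => partial1 f2 (x, s, 0))).
        -- intros u t. now apply C1_fun_line1.
        -- intros u t. C1_slice_continuous.
        -- intros u t. C1_slice_continuous.
      * apply (is_derive_RInt_slice (fun x s => f3 (x, y, s)) (fun x s => partial1 f3 (x, y, s))).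
        -- intros u t. now apply C1_fun_line1.
        -- intros u t. C1_slice_continuous.
        -- intros u t. C1_slice_continuous.
    + rewrite (RInt_ext _ (fun s => partial2 f1 (x, s, 0))) by (intros; apply E21).
      rewrite (RInt_ext (fun s => partial1 f3 (x, y, s)) (fun s => partial3 f1 (x, y, s)))
        by (intros; apply E13).
      rewrite (RInt_derive_eq (fun s => f1 (x, s, 0))), (RInt_derive_eq (fun s => f1 (x, y, s))).
      * ring.
      * intros s. now apply C1_fun_line3.
      * intros s. C1_slice_continuous.
      * intros s. now apply C1_fun_line2.
      * intros s. C1_slice_continuous.
  - intros [[x y] z]. unfold line2, c1, c2, c3; simpl.
    replace (f2 (x, y, z)) with (0 + f2 (x, y, 0) + RInt (fun s => partial2 f3 (x, y, s)) 0 z).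
    + apply (is_derive_plus (V := R_NormedModule)); [apply (is_derive_plus (V := R_NormedModule))|].
      * apply (is_derive_const (V := R_NormedModule)).
      * apply (is_derive_RInt_upper (fun s => f2 (x, s, 0))). intros s. C1_slice_continuous.
      * apply (is_derive_RInt_slice (fun y s => f3 (x, y, s)) (fun y s => partial2 f3 (x, y, s))).
        -- intros u t. now apply C1_fun_line2.
        -- intros u t. C1_slice_continuous.
        -- intros u t. C1_slice_continuous.
    + rewrite (RInt_ext _ (fun s => partial3 f2 (x, y, s))) by (intros; apply E32).
      rewrite (RInt_derive_eq (fun s => f2 (x, y, s))).
      * ring.
      * intros s. now apply C1_fun_line3.
      * intros s. C1_slice_continuous.
  - intros [[x y] z]. unfold line3, c1, c2, c3; simpl.
    replace (f3 (x, y, z)) with (0 + f3 (x, y, z)) by ring.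
    apply (is_derive_plus (V := R_NormedModule)).
    + apply (is_derive_const (V := R_NormedModule)).
    + apply (is_derive_RInt_upper (fun s => f3 (x, y, s))). intros s. C1_slice_continuous.
Qed.

Lemma loop_curl (f : R3 -> R3) (a b : R) (gamma : R -> R3) :
  C1_field f -> closed_loop a b gamma -> line_integral f gamma a b <> 0 ->
  ~ (forall v : R3, curl f v = (0, 0, 0)).
Proof.
  intros Hf Hg Hl Hcurl. destruct (curl_free_potential f Hf Hcurl) as [phi Hphi].
  apply Hl, (conservative_loop f phi); trivial. intros v. now apply C1_field_continuous.
Qed.

(** * Steering with continuous controls *)

(** Reachability by controls that vanish outside [[0, T]], the state resting at [p] before and at
    [q] after. As [u] and [x] live on the whole line and nothing happens at a break point, such
    motions can be reversed and concatenated without case distinctions on regularity. *)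
Definition steers (f : R3 -> R3) (p q : R4) : Prop :=
  exists (T : R) (u : R -> R3) (x : R -> R4),
    0 < T /\ (forall t, continuous u t) /\ (forall t, t <= 0 \/ T <= t -> u t = zero) /\
    (forall t, is_derive x t (system_rhs f (x t) (u t))) /\
    (forall t, t <= 0 -> x t = p) /\ (forall t, T <= t -> x t = q).

Lemma system_rhs_linear (f : R3 -> R3) (x : R4) : is_linear (system_rhs f x).
Proof.
  unfold system_rhs. repeat apply is_linear_prod;
    [apply is_linear_c1 | apply is_linear_c2 | apply is_linear_c3 | apply is_linear_dot].
Qed.

Lemma system_rhs_zero (f : R3 -> R3) (x : R4) : system_rhs f x zero = zero.
Proof. apply (linear_zero _ (system_rhs_linear f x)). Qed.

Lemma system_rhs_plus (f : R3 -> R3) (x : R4) (u v : R3) :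
  system_rhs f x (plus u v) = plus (system_rhs f x u) (system_rhs f x v).
Proof. apply (linear_plus _ (system_rhs_linear f x)). Qed.

Lemma system_rhs_scal (f : R3 -> R3) (x : R4) (k : R) (u : R3) :
  system_rhs f x (scal k u) = scal k (system_rhs f x u).
Proof. apply (linear_scal _ (system_rhs_linear f x)). Qed.

Lemma steers_controllable (f : R3 -> R3) : (forall p q, steers f p q) -> controllable f.
Proof.
  intros Hs p q. destruct (Hs p q) as [T [u [x [HT [Hu [_ [Hx [H0 H1]]]]]]]].
  exists T, u, x.
  assert (HC : forall g : R -> R, (forall t, continuous g t) -> piecewise_continuous 0 T g).
  { intros g Hg. apply (partition_of_pieces (continuous_piece g)).
    apply pieces_cons with T; [trivial| |constructor]. now apply continuous_piece_continuous. }
  split; [trivial|]. split; [|split; [|split; [|split; [|split]]]].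
  - apply HC. intros t. apply (continuous_comp u c1); [apply Hu | apply continuous_c1].
  - apply HC. intros t. apply (continuous_comp u c2); [apply Hu | apply continuous_c2].
  - apply HC. intros t. apply (continuous_comp u c3); [apply Hu | apply continuous_c3].
  - split; [|auto]. intros t _. apply continuous_within.
    apply (ex_derive_continuous x). eexists. apply Hx.
  - apply H0. lra.
  - apply H1. lra.
Qed.

Lemma steers_refl (f : R3 -> R3) (p : R4) : steers f p p.
Proof.
  exists 1, (fun _ => zero), (fun _ => p). split; [lra|]. split; [|split; [|split]]; auto.
  - intros t. apply continuous_const.
  - intros t. rewrite system_rhs_zero. apply @is_derive_const.
Qed.

Lemma is_derive_affine_comp (V : NormedModule R_AbsRing) (x : R -> V) (dx : V) (k b t : R) :
  is_derive x (k * t + b) dx -> is_derive (fun s => x (k * s + b)) t (scal k dx).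
Proof.
  intros Hx. apply (is_derive_comp x (fun s => k * s + b) t dx k Hx).
  auto_derive; trivial. ring.
Qed.

Lemma continuous_affine_comp (U : UniformSpace) (u : R -> U) (k b t : R) :
  (forall s, continuous u s) -> continuous (fun s => u (k * s + b)) t.
Proof.
  intros Hu. apply (continuous_comp (fun s => k * s + b) u); [|apply Hu].
  apply (ex_derive_continuous (fun s => k * s + b)). auto_derive; trivial.
Qed.

(** Time reversal, the system having no drift. *)
Lemma steers_sym (f : R3 -> R3) (p q : R4) : steers f p q -> steers f q p.
Proof.
  intros [T [u [x [HT [Hu [Hu0 [Hx [H0 H1]]]]]]]].
  exists T, (fun t => scal (-1) (u (-1 * t + T))), (fun t => x (-1 * t + T)).
  split; [trivial|]. split; [|split; [|split; [|split]]].
  - intros t. apply (continuous_scal_r (K := R_AbsRing) (-1) (fun s => u (-1 * s + T))).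
    now apply continuous_affine_comp.
  - intros t Ht. rewrite Hu0 by lra. apply @scal_zero_r.
  - intros t. rewrite system_rhs_scal.
    apply is_derive_affine_comp, Hx.
  - intros t Ht. apply H1. lra.
  - intros t Ht. apply H0. lra.
Qed.

Lemma plus_minus_diag (a q : R4) : plus a (minus q q) = a.
Proof.
  apply (eq_trans (f_equal (plus a) (minus_eq_zero q))). apply @plus_zero_r.
Qed.

Lemma plus_minus_cancel (a q : R4) : plus q (minus a q) = a.
Proof.
  apply (eq_trans (plus_comm q (minus a q))).
  apply (eq_trans (eq_sym (plus_assoc a (opp q) q))).
  apply (eq_trans (f_equal (plus a) (plus_opp_l q))). apply @plus_zero_r.
Qed.

(** The second motion starts when the first one has stopped, so that at any time one of the two
    controls is 0 and the sum of the displacements is a trajectory, although the system is not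
    linear in the state. *)
Lemma steers_trans (f : R3 -> R3) (p q r : R4) : steers f p q -> steers f q r -> steers f p r.
Proof.
  intros [T [u [x [HT [Hu [Hu0 [Hx [H0 H1]]]]]]]] [S [v [y [HS [Hv [Hv0 [Hy [K0 K1]]]]]]]].
  exists (T + S), (fun t => plus (u t) (v (1 * t + - T))),
    (fun t => plus (x t) (minus (y (1 * t + - T)) q)).
  split; [lra|]. split; [|split; [|split; [|split]]].
  - intros t. apply (continuous_plus u (fun t => v (1 * t + - T))); [apply Hu|].
    now apply continuous_affine_comp.
  - intros t Ht. rewrite Hu0, Hv0 by lra. apply @plus_zero_l.
  - intros t. rewrite system_rhs_plus.
    apply (is_derive_plus x (fun t => minus (y (1 * t + - T)) q)).
    + destruct (Rle_lt_dec t T) as [Ht|Ht].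
      * rewrite (K0 (1 * t + - T)), plus_minus_diag by lra. apply Hx.
      * rewrite (Hu0 t) by lra. generalize (Hx t). rewrite (Hu0 t) by lra.
        now rewrite !system_rhs_zero.
    + rewrite <- (minus_zero_r (system_rhs f _ (v (1 * t + - T)))).
      apply (is_derive_minus (fun t => y (1 * t + - T)) (fun _ => q)); [|apply @is_derive_const].
      rewrite <- (scal_one (system_rhs f _ (v (1 * t + - T)))).
      apply is_derive_affine_comp.
      destruct (Rle_lt_dec t T) as [Ht|Ht].
      * generalize (Hy (1 * t + - T)). rewrite (Hv0 (1 * t + - T)) by lra.
        now rewrite !system_rhs_zero.
      * rewrite (H1 t), plus_minus_cancel by lra. apply Hy.
  - intros t Ht. rewrite H0, K0 by lra. apply plus_minus_diag.
  - intros t Ht. rewrite H1, K1 by lra. apply plus_minus_cancel.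
Qed.

(** The function [6 t (1 - t)], of integral 1, cut off outside the unit interval. *)
Definition bump (t : R) : R := 6 * clamp 0 1 t * (1 - clamp 0 1 t).

Definition smooth_step (t : R) : R := RInt bump 0 t.

Lemma bump_continuous (t : R) : continuous bump t.
Proof.
  apply (continuous_comp (clamp 0 1) (fun c => 6 * c * (1 - c))); [apply clamp_continuous|].
  apply (ex_derive_continuous (fun c => 6 * c * (1 - c))). auto_derive; trivial.
Qed.

Lemma bump_outside (t : R) : t <= 0 \/ 1 <= t -> bump t = 0.
Proof.
  intros Ht. unfold bump. destruct Ht as [Ht|Ht].
  - replace (clamp 0 1 t) with 0; [ring|].
    unfold clamp, Rmax, Rmin. repeat destruct Rle_dec; lra.
  - replace (clamp 0 1 t) with 1; [ring|].
    unfold clamp, Rmax, Rmin. repeat destruct Rle_dec; lra.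
Qed.

Lemma smooth_step_derive (t : R) : is_derive smooth_step t (bump t).
Proof. apply is_derive_RInt_upper. exact bump_continuous. Qed.

Lemma RInt_bump_outside (a b : R) : (a <= 0 /\ b <= 0) \/ (1 <= a /\ 1 <= b) -> RInt bump a b = 0.
Proof.
  intros H. rewrite (RInt_ext _ (fun _ => 0)).
  - rewrite RInt_const. apply Rmult_0_r.
  - intros s. unfold Rmin, Rmax. destruct Rle_dec; intros Hs; apply bump_outside; lra.
Qed.

Lemma smooth_step_left (t : R) : t <= 0 -> smooth_step t = 0.
Proof. intros Ht. apply RInt_bump_outside. lra. Qed.

Lemma smooth_step_right (t : R) : 1 <= t -> smooth_step t = 1.
Proof.
  intros Ht. unfold smooth_step.
  assert (Hex : forall a b, ex_RInt bump a b).
  { intros a b. apply (ex_RInt_continuous bump). intros s _. apply bump_continuous. }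
  rewrite <- (RInt_Chasles bump 0 1 t) by apply Hex.
  rewrite (RInt_bump_outside 1 t) by lra.
  rewrite (RInt_ext _ (fun s => 6 * s * (1 - s))).
  - rewrite (RInt_derive_eq (fun s => 3 * s ^ 2 - 2 * s ^ 3)).
    + unfold plus; simpl. ring.
    + intros s. auto_derive; trivial. ring.
    + intros s. apply (ex_derive_continuous (fun c => 6 * c * (1 - c))). auto_derive; trivial.
  - rewrite Rmin_left, Rmax_right by lra. intros s Hs. unfold bump. now rewrite clamp_id by lra.
Qed.

(** The right-hand side of the system does not involve the fourth state, so what matters is its
    increment [c], whatever the initial value [z]. *)
Definition steers_cost (f : R3 -> R3) (v w : R3) (c : R) : Prop :=
  forall z : R, steers f (v, z) (w, z + c).

Lemma steers_cost_sym (f : R3 -> R3) (v w : R3) (c : R) :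
  steers_cost f v w c -> steers_cost f w v (- c).
Proof.
  intros H z. apply steers_sym. replace z with (z + - c + c) at 2 by ring. apply H.
Qed.

Lemma steers_cost_trans (f : R3 -> R3) (v w r : R3) (c d : R) :
  steers_cost f v w c -> steers_cost f w r d -> steers_cost f v r (c + d).
Proof.
  intros H K z. apply steers_trans with (w, z + c); [apply H|].
  rewrite <- Rplus_assoc. apply K.
Qed.

Lemma steers_cost_iter (f : R3 -> R3) (v : R3) (c : R) (n : nat) :
  steers_cost f v v c -> steers_cost f v v (INR n * c).
Proof.
  intros H. induction n as [|n IH].
  - intros z. simpl. rewrite Rmult_0_l, Rplus_0_r. apply steers_refl.
  - rewrite S_INR, Rmult_plus_distr_r, Rmult_1_l. now apply steers_cost_trans with v.
Qed.

Definition displacement (v w : R3) : R3 := (c1 w - c1 v, c2 w - c2 v, c3 w - c3 v).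

Definition segment (v w : R3) (t : R) : R3 :=
  (c1 v + t * (c1 w - c1 v), c2 v + t * (c2 w - c2 v), c3 v + t * (c3 w - c3 v)).

Lemma segment_0 (v w : R3) : segment v w 0 = v.
Proof. destruct v as [[? ?] ?]. unfold segment, c1, c2, c3; simpl. repeat f_equal; ring. Qed.

Lemma segment_1 (v w : R3) : segment v w 1 = w.
Proof. destruct w as [[? ?] ?]. unfold segment, c1, c2, c3; simpl. repeat f_equal; ring. Qed.

(** The segment is run with the time law [smooth_step], for which the controls [bump t * d] start
    and end at 0; [F] is the line integral of [f] along the segment as a function of its
    parameter. *)
Lemma steers_segment (f : R3 -> R3) (v w : R3) (F : R -> R) :
  (forall t, is_derive F t (dot (f (segment v w t)) (displacement v w))) -> F 0 = 0 ->
  steers_cost f v w (F 1).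
Proof.
  intros HF HF0 z.
  set (d := displacement v w) in *.
  exists 1, (fun t => (bump t * c1 d, bump t * c2 d, bump t * c3 d)),
    (fun t => (segment v w (smooth_step t), z + F (smooth_step t))).
  split; [lra|]. split; [|split; [|split; [|split]]].
  - intros t.
    assert (Hb : forall k, continuous (fun s => bump s * k) t).
    { intros k. apply (continuous_comp bump (fun r => r * k)); [apply bump_continuous|].
      apply (ex_derive_continuous (fun r => r * k)). auto_derive; trivial. }
    apply continuous_triple; apply Hb.
  - intros t Ht. rewrite bump_outside by trivial. rewrite !Rmult_0_l. reflexivity.
  - intros t.
    assert (Hcomp : forall h dh, is_derive h (smooth_step t) dh ->
      is_derive (fun s => h (smooth_step s)) t (bump t * dh)).
    { intros h dh Hh. exact (is_derive_comp h smooth_step t dh (bump t) Hh (smooth_step_derive t)). }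
    assert (Haff : forall a k, is_derive (fun s => a + smooth_step s * k) t (bump t * k)).
    { intros a k. apply (Hcomp (fun r => a + r * k)). auto_derive; trivial. ring. }
    unfold system_rhs. repeat apply is_derive_pair; try apply Haff.
    assert (Hdot : forall y k, dot y (k * c1 d, k * c2 d, k * c3 d) = k * dot y d).
    { intros y k. unfold dot, c1, c2, c3. cbn [fst snd]. ring. }
    rewrite Hdot, <- (Rplus_0_l (dot _ d)).
    apply (Hcomp (fun r => z + F r)).
    apply (is_derive_plus (V := R_NormedModule)); [apply (is_derive_const (V := R_NormedModule))|].
    apply HF.
  - intros t Ht. now rewrite smooth_step_left, segment_0, HF0, Rplus_0_r by trivial.
  - intros t Ht. now rewrite smooth_step_right, segment_1 by trivial.
Qed.

Lemma is_derive_RInt_affine (h : R -> R) (a b t : R) :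
  (forall s, continuous h s) ->
  is_derive (fun s => RInt h a (a + s * (b - a))) t (h (a + t * (b - a)) * (b - a)).
Proof.
  intros Hh. rewrite Rmult_comm.
  apply (is_derive_comp (fun y => RInt h a y) (fun s => a + s * (b - a)) t _ (b - a)).
  - now apply is_derive_RInt_upper.
  - auto_derive; trivial. ring.
Qed.

Lemma steers_axis1 (f : R3 -> R3) (x y z x' : R) :
  C1_field f -> steers_cost f (x, y, z) (x', y, z) (RInt (fun s => c1 (f (s, y, z))) x x').
Proof.
  intros [F1 [F2 F3]].
  replace (RInt _ _ _) with (RInt (fun s => c1 (f (s, y, z))) x (x + 1 * (x' - x)))
    by (apply f_equal; ring).
  apply (steers_segment f (x, y, z) (x', y, z)
    (fun t => RInt (fun s => c1 (f (s, y, z))) x (x + t * (x' - x)))).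
  - intros t.
    replace (dot _ _) with (c1 (f (x + t * (x' - x), y, z)) * (x' - x)).
    + apply (is_derive_RInt_affine (fun s => c1 (f (s, y, z)))).
      intros s. apply (continuous_comp_triple _ (fun v => c1 (f v)));
        [intros v; now apply C1_fun_continuous | apply continuous_id || apply continuous_const ..].
    + unfold segment, displacement, dot, c1, c2, c3. cbn [fst snd].
      rewrite !Rminus_diag, !Rmult_0_r, !Rplus_0_r. ring.
  - rewrite Rmult_0_l, Rplus_0_r. apply (RInt_point (V := R_CompleteNormedModule)).
Qed.

Lemma steers_axis2 (f : R3 -> R3) (x y z y' : R) :
  C1_field f -> steers_cost f (x, y, z) (x, y', z) (RInt (fun s => c2 (f (x, s, z))) y y').
Proof.
  intros [F1 [F2 F3]].
  replace (RInt _ _ _) with (RInt (fun s => c2 (f (x, s, z))) y (y + 1 * (y' - y)))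
    by (apply f_equal; ring).
  apply (steers_segment f (x, y, z) (x, y', z)
    (fun t => RInt (fun s => c2 (f (x, s, z))) y (y + t * (y' - y)))).
  - intros t.
    replace (dot _ _) with (c2 (f (x, y + t * (y' - y), z)) * (y' - y)).
    + apply (is_derive_RInt_affine (fun s => c2 (f (x, s, z)))).
      intros s. apply (continuous_comp_triple _ (fun v => c2 (f v)));
        [intros v; now apply C1_fun_continuous | apply continuous_id || apply continuous_const ..].
    + unfold segment, displacement, dot, c1, c2, c3. cbn [fst snd].
      rewrite !Rminus_diag, !Rmult_0_r, !Rplus_0_r. ring.
  - rewrite Rmult_0_l, Rplus_0_r. apply (RInt_point (V := R_CompleteNormedModule)).
Qed.

Lemma steers_axis3 (f : R3 -> R3) (x y z z' : R) :
  C1_field f -> steers_cost f (x, y, z) (x, y, z') (RInt (fun s => c3 (f (x, y, s))) z z').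
Proof.
  intros [F1 [F2 F3]].
  replace (RInt _ _ _) with (RInt (fun s => c3 (f (x, y, s))) z (z + 1 * (z' - z)))
    by (apply f_equal; ring).
  apply (steers_segment f (x, y, z) (x, y, z')
    (fun t => RInt (fun s => c3 (f (x, y, s))) z (z + t * (z' - z)))).
  - intros t.
    replace (dot _ _) with (c3 (f (x, y, z + t * (z' - z))) * (z' - z)).
    + apply (is_derive_RInt_affine (fun s => c3 (f (x, y, s)))).
      intros s. apply (continuous_comp_triple _ (fun v => c3 (f v)));
        [intros v; now apply C1_fun_continuous | apply continuous_id || apply continuous_const ..].
    + unfold segment, displacement, dot, c1, c2, c3. cbn [fst snd].
      rewrite !Rminus_diag, !Rmult_0_r, !Rplus_0_r. ring.
  - rewrite Rmult_0_l, Rplus_0_r. apply (RInt_point (V := R_CompleteNormedModule)).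
Qed.

(** * Small rectangles and the curl *)

(** The integral of [P dx + Q dy] around the rectangle with opposite corners [(x0, y0)] and
    [(x, y)], starting along the first axis. *)
Definition circulation (P Q : R -> R -> R) (x0 y0 x y : R) : R :=
  RInt (fun s => P s y0) x0 x + RInt (Q x) y0 y - RInt (fun s => P s y) x0 x - RInt (Q x0) y0 y.

Lemma circulation_cost (f : R3 -> R3) (e : R -> R -> R3) (P Q : R -> R -> R) (x0 y0 x y : R) :
  (forall s s' t, steers_cost f (e s t) (e s' t) (RInt (fun r => P r t) s s')) ->
  (forall s t t', steers_cost f (e s t) (e s t') (RInt (Q s) t t')) ->
  steers_cost f (e x0 y0) (e x0 y0) (circulation P Q x0 y0 x y).
Proof.
  intros horizontal vertical. unfold circulation, Rminus.
  apply steers_cost_trans with (e x0 y).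
  - apply steers_cost_trans with (e x y).
    + apply steers_cost_trans with (e x y0); [apply horizontal | apply vertical].
    + apply steers_cost_sym, horizontal.
  - apply steers_cost_sym, vertical.
Qed.

Lemma circulation_derive (P Q Qx : R -> R -> R) (x0 y0 x y : R) :
  (forall s t, continuous (fun r => P r t) s) ->
  (forall s t, continuous (Q s) t) ->
  (forall s t, is_derive (fun r => Q r t) s (Qx s t)) ->
  (forall s t, continuous (fun z : R * R => Qx (fst z) (snd z)) (s, t)) ->
  is_derive (fun s => circulation P Q x0 y0 s y) x (P x y0 + RInt (Qx x) y0 y - P x y).
Proof.
  intros HP HQ HdQ HQx.
  replace (P x y0 + RInt (Qx x) y0 y - P x y) with (P x y0 + RInt (Qx x) y0 y - P x y - 0) by ring.
  apply (is_derive_minus (V := R_NormedModule)); [|apply (is_derive_const (V := R_NormedModule))].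
  apply (is_derive_minus (V := R_NormedModule)).
  - apply (is_derive_plus (V := R_NormedModule)).
    + apply (is_derive_RInt_upper (fun s => P s y0)). auto.
    + apply (is_derive_RInt_slice Q Qx); auto.
  - apply (is_derive_RInt_upper (fun s => P s y)). auto.
Qed.

(** If the circulation were identically 0, so would be its derivative in [x] at [x0], and
    then the derivative of the latter in [y] at [y0], which is the left side minus the right side
    of the assumed inequality. *)
Lemma circulation_nonzero (P Q Py Qx : R -> R -> R) (x0 y0 : R) :
  (forall s t, continuous (fun r => P r t) s) ->
  (forall s t, continuous (Q s) t) ->
  (forall s t, is_derive (P s) t (Py s t)) ->
  (forall s t, is_derive (fun r => Q r t) s (Qx s t)) ->
  (forall s t, continuous (fun z : R * R => Qx (fst z) (snd z)) (s, t)) ->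
  Qx x0 y0 <> Py x0 y0 -> exists x y, circulation P Q x0 y0 x y <> 0.
Proof.
  intros HP HQ HdP HdQ HQx Hne. apply NNPP. intros Hno.
  assert (Hz : forall x y, circulation P Q x0 y0 x y = 0).
  { intros x y. apply NNPP. intros H. apply Hno. now exists x, y. }
  assert (Hz' : forall y, P x0 y0 + RInt (Qx x0) y0 y - P x0 y = 0).
  { intros y. rewrite <- (is_derive_unique _ _ _ (circulation_derive P Q Qx x0 y0 x0 y HP HQ HdQ HQx)).
    rewrite (Derive_ext _ (fun _ => 0)) by auto. apply Derive_const. }
  apply Hne, Rminus_diag_uniq.
  assert (Hd : is_derive (fun y => P x0 y0 + RInt (Qx x0) y0 y - P x0 y) y0 (0 + Qx x0 y0 - Py x0 y0)).
  { apply (is_derive_minus (V := R_NormedModule)); [|apply HdP].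
    apply (is_derive_plus (V := R_NormedModule)); [apply (is_derive_const (V := R_NormedModule))|].
    apply is_derive_RInt_upper. intros s.
    apply (continuous_comp (fun s => (x0, s)) (fun z => Qx (fst z) (snd z))); [|apply HQx].
    apply continuous_pair; [apply continuous_const | apply continuous_id]. }
  apply is_derive_unique in Hd. rewrite (Derive_ext _ (fun _ => 0)), Derive_const in Hd by auto.
  lra.
Qed.

(** In a plane parametrized by [e], where [P] and [Q] are the components of the field: the
    circulation vanishes on the degenerate rectangle [x = x0] and is continuous in [x], so its
    values fill an interval from 0 to some [D] that is not 0; reversed and repeated loops yield
    every real number. *)
Lemma rectangle_loops (f : R3 -> R3) (e : R -> R -> R3) (P Q Py Qx : R -> R -> R) (x0 y0 c : R) :
  (forall s s' t, steers_cost f (e s t) (e s' t) (RInt (fun r => P r t) s s')) ->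
  (forall s t t', steers_cost f (e s t) (e s t') (RInt (Q s) t t')) ->
  (forall s t, continuous (fun r => P r t) s) ->
  (forall s t, continuous (Q s) t) ->
  (forall s t, is_derive (P s) t (Py s t)) ->
  (forall s t, is_derive (fun r => Q r t) s (Qx s t)) ->
  (forall s t, continuous (fun z : R * R => Qx (fst z) (snd z)) (s, t)) ->
  Qx x0 y0 <> Py x0 y0 -> steers_cost f (e x0 y0) (e x0 y0) c.
Proof.
  intros horizontal vertical HP HQ HdP HdQ HQx Hne.
  destruct (circulation_nonzero P Q Py Qx x0 y0 HP HQ HdP HdQ HQx Hne) as [x [y Hxy]].
  set (D := circulation P Q x0 y0 x y) in *.
  assert (Hivt : forall d, Rmin 0 D <= d <= Rmax 0 D -> steers_cost f (e x0 y0) (e x0 y0) d).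
  { intros d Hd.
    assert (H0 : circulation P Q x0 y0 x0 y = 0).
    { unfold circulation. rewrite !RInt_point. unfold zero; simpl. ring. }
    destruct (IVT_gen (fun s => circulation P Q x0 y0 s y) x0 x d) as [s [_ <-]].
    - intros s. apply continuity_pt_filterlim.
      apply (ex_derive_continuous (fun s => circulation P Q x0 y0 s y)). eexists.
      now apply (circulation_derive P Q Qx).
    - now rewrite H0.
    - now apply circulation_cost. }
  assert (HD := Rabs_pos_lt _ Hxy).
  destruct (INR_archimed (Rabs D) (Rabs c) HD) as [n Hn].
  assert (Hn0 : 0 < INR n).
  { destruct n; [|apply lt_0_INR; lia]. simpl in Hn. generalize (Rabs_pos c). lra. }
  (* [n] turns around one rectangle, each contributing [c / n], which is within reach of [Hivt]
     up to the orientation of the turn. *)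
  replace c with (INR n * (c / INR n)) by (field; lra).
  apply steers_cost_iter.
  assert (Hc : Rabs (c / INR n) <= Rabs D).
  { unfold Rdiv. rewrite Rabs_mult, Rabs_inv, (Rabs_pos_eq (INR n)) by lra.
    apply Rmult_le_reg_r with (INR n); trivial. field_simplify; lra. }
  set (d := c / INR n) in *. clearbody d.
  destruct (Rle_lt_dec 0 (d * D)) as [Hs|Hs].
  - apply Hivt. revert Hc Hs.
    unfold Rmin, Rmax, Rabs. repeat destruct Rcase_abs; destruct Rle_dec; nra.
  - rewrite <- (Ropp_involutive d). apply steers_cost_sym, Hivt. revert Hc Hs.
    unfold Rmin, Rmax, Rabs. repeat destruct Rcase_abs; destruct Rle_dec; nra.
Qed.

Lemma steers_cost_exists (f : R3 -> R3) (v w : R3) :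
  C1_field f -> exists c, steers_cost f v w c.
Proof.
  intros Hf. destruct v as [[x y] z], w as [[x' y'] z']. eexists.
  eapply steers_cost_trans; [eapply steers_cost_trans|].
  - apply (steers_axis1 f x y z x' Hf).
  - apply (steers_axis2 f x' y z y' Hf).
  - apply (steers_axis3 f x' y' z z' Hf).
Qed.

(** One of the three coordinate planes through [v] sees a nonzero component of the curl. *)
Lemma curl_loops (f : R3 -> R3) (v : R3) (c : R) :
  C1_field f -> curl f v <> (0, 0, 0) -> steers_cost f v v c.
Proof.
  intros Hf Hcurl. assert (Hf' := Hf). destruct Hf' as [F1 [F2 F3]].
  destruct v as [[x y] z].
  set (f1 := fun v => c1 (f v)) in *. set (f2 := fun v => c2 (f v)) in *.
  set (f3 := fun v => c3 (f v)) in *.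
  assert (Hor : partial2 f3 (x, y, z) <> partial3 f2 (x, y, z) \/
    partial1 f3 (x, y, z) <> partial3 f1 (x, y, z) \/
    partial1 f2 (x, y, z) <> partial2 f1 (x, y, z)).
  { apply NNPP. intros Hno. apply Hcurl. unfold curl. fold f1 f2 f3.
    repeat apply f_equal2; apply Rminus_diag_eq; apply NNPP; intros H; apply Hno; auto. }
  destruct Hor as [H|[H|H]].
  - apply (rectangle_loops f (fun s t => (x, s, t)) (fun s t => f2 (x, s, t)) (fun s t => f3 (x, s, t))
      (fun s t => partial3 f2 (x, s, t)) (fun s t => partial2 f3 (x, s, t)) y z); trivial;
      intros s t; try C1_slice_continuous.
    + intros r. now apply steers_axis2.
    + intros r. now apply steers_axis3.
    + now apply C1_fun_line3.
    + now apply C1_fun_line2.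
  - apply (rectangle_loops f (fun s t => (s, y, t)) (fun s t => f1 (s, y, t)) (fun s t => f3 (s, y, t))
      (fun s t => partial3 f1 (s, y, t)) (fun s t => partial1 f3 (s, y, t)) x z); trivial;
      intros s t; try C1_slice_continuous.
    + intros r. now apply steers_axis1.
    + intros r. now apply steers_axis3.
    + now apply C1_fun_line3.
    + now apply C1_fun_line1.
  - apply (rectangle_loops f (fun s t => (s, t, z)) (fun s t => f1 (s, t, z)) (fun s t => f2 (s, t, z))
      (fun s t => partial2 f1 (s, t, z)) (fun s t => partial1 f2 (s, t, z)) x y); trivial;
      intros s t; try C1_slice_continuous.
    + intros r. now apply steers_axis1.
    + intros r. now apply steers_axis2.
    + now apply C1_fun_line2.
    + now apply C1_fun_line1.
Qed.

Lemma curl_controllable (f : R3 -> R3) :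
  C1_field f -> ~ (forall v : R3, curl f v = (0, 0, 0)) -> controllable f.
Proof.
  intros Hf Hcurl. apply not_all_ex_not in Hcurl. destruct Hcurl as [v Hv].
  apply steers_controllable. intros [p a] [q b].
  destruct (steers_cost_exists f p v Hf) as [c Hc].
  destruct (steers_cost_exists f v q Hf) as [d Hd].
  replace b with (a + (c + (b - a - c - d) + d)) by ring.
  apply (steers_cost_trans f p v q); [|exact Hd].
  apply (steers_cost_trans f p v v); [exact Hc|]. now apply curl_loops.
Qed.

Theorem mainTheorem1 (f : R3 -> R3) (hf : C1_field f) :
  (controllable f <->
     exists (a b : R) (gamma : R -> R3),
       closed_loop a b gamma /\ line_integral f gamma a b <> 0) /\
  ((exists (a b : R) (gamma : R -> R3),
       closed_loop a b gamma /\ line_integral f gamma a b <> 0) <->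
     ~ (forall v : R3, curl f v = (0, 0, 0))).
Proof.
  assert (H12 := controllable_loop f hf).
  assert (H23 : (exists (a b : R) (gamma : R -> R3),
    closed_loop a b gamma /\ line_integral f gamma a b <> 0) ->
    ~ (forall v : R3, curl f v = (0, 0, 0))).
  { intros [a [b [gamma [Hg Hl]]]]. now apply (loop_curl f a b gamma). }
  assert (H31 := curl_controllable f hf).
  split; split; auto.
Qed.
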